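(* Let $(X,\widehat{d}_X)$ and $(Y,\widehat{d}_Y)$ be two compact non-Archimedean metric spaces and let $\varepsilon>0$. (1) If $X$ and $Y$ are strong $\varepsilon$-approximations of each other, then $\widehat{d}_{GH}(X,Y)\le\varepsilon$. (2) If $\widehat{d}_{GH}(X,Y)<\varepsilon$, then $X$ and $Y$ are strong $\varepsilon$-approximations of each other.
   Context: A non-Archimedean metric space $(X,\widehat{d}_X)$ is a set with a metric satisfying the strong triangle inequality $\widehat{d}_X(x,z)\le\max\{\widehat{d}_X(x,y),\widehat{d}_X(y,z)\}$. The non-Archimedean Gromov-Hausdorff distance is $\widehat{d}_{GH}(X,Y)=\inf\{\widehat{d}_{H}(f(X),g(Y))\}$, the infimum being over all non-Archimedean metric spaces $(Z,\widehat{d}_Z)$ and all isometric embeddings $f:X\hookrightarrow Z$, $g:Y\hookrightarrow Z$, where $\widehat{d}_H$ is the Hausdorff distance between subsets of $Z$. A subset $S$ of a metric space $(X,d)$ is an $\varepsilon$-net if $\operatorname{dist}(x,S)=\inf_{s\in S}d(x,s)<\varepsilon$ for all $x\in X$. Two compact non-Archimedean metric spaces $X$ and $Y$ are strong $\varepsilon$-approximations of each other ($\varepsilon>0$) if there exist finite collections of points $\{x_i\}_{i=1}^N$ in $X$ and $\{y_i\}_{i=1}^N$ in $Y$ such that: (1) the set $\{x_i:1\le i\le N\}$ is an $\varepsilon$-net in $X$ and $\{y_i:1\le i\le N\}$ is an $\varepsilon$-net in $Y$; (2) $\widehat{d}_X(x_i,x_j)=\widehat{d}_Y(y_i,y_j)$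 for all $i,j\in\{1,\dots,N\}$. *)

(* Defs.v *)
From HB Require Import structures.
From mathcomp Require Import all_boot all_order all_algebra.
From mathcomp Require Import all_classical all_reals all_analysis.

Set Implicit Arguments.
Unset Strict Implicit.
Unset Printing Implicit Defensive.

Import Order.TTheory GRing.Theory Num.Theory.

Local Open Scope classical_set_scope.
Local Open Scope ring_scope.

Definition non_archimedean (R : realType) (X : metricType R) : Prop :=
  forall x y z : X, mdist x z <= Num.max (mdist x y) (mdist y z).

(* dist(x, S); it is +oo when S is empty. *)
Definition set_dist (R : realType) (X : metricType R) (x : X) (S : set X)
    : \bar R :=
  ereal_inf [set (mdist x s)%:E | s in S].

Definition eps_net (R : realType) (X : metricType R) (eps : R) (S : set X)
    : Prop :=
  forall x : X, (set_dist x S < eps%:E)%E.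

Definition thickening (R : realType) (X : metricType R) (r : R) (S : set X)
    : set X :=
  [set x | (set_dist x S < r%:E)%E].

(* Extended-real valued: the distance is +oo between sets with no common
   finite thickening radius, e.g. when exactly one of them is empty. *)
Definition hausdorff_dist (R : realType) (Z : metricType R) (A B : set Z)
    : \bar R :=
  ereal_inf [set r%:E | r in
    [set r : R | [/\ 0 < r, A `<=` thickening r B & B `<=` thickening r A]]].

Definition isometric_embedding (R : realType) (X Z : metricType R)
    (f : X -> Z) : Prop :=
  forall x x' : X, mdist (f x) (f x') = mdist x x'.

Definition na_gh_dist (R : realType) (X Y : metricType R) : \bar R :=
  ereal_inf [set d : \bar R | exists (Z : metricType R) (f : X -> Z) (g : Y -> Z),
    [/\ non_archimedean Z, isometric_embedding f, isometric_embedding g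
      & d = hausdorff_dist (range f) (range g)]].

Definition strong_approximations (R : realType) (eps : R) (X Y : metricType R)
    : Prop :=
  exists (N : nat) (x : 'I_N -> X) (y : 'I_N -> Y),
    [/\ eps_net eps (range x), eps_net eps (range y)
      & forall i j : 'I_N, mdist (x i) (x j) = mdist (y i) (y j)].

(* Main.v *)
(** For (1), an index assignment [e : Y -> 'I_N] with [d(y, y_(e y)) < eps]
    gives a map [phi y = x_(e y)] which preserves distances up to [eps]. Setting
    [d(x, y) = max(eps, d(x, phi y))] then glues X and Y into an ultrametric
    space in which [x_i] and [y_i] are at distance [eps].
    For (2), choose one representative in each open [eps]-ball of X; by
    compactness there are finitely many, and they are pairwise at distance at
    least [eps]. Moving each of them by less than [eps] to a point of Y inside
    the common space does not change their mutual distances, because triangles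
    are isosceles. *)
Require Import Defs.
From HB Require Import structures.
From mathcomp Require Import all_boot all_order all_algebra.
From mathcomp Require Import all_classical all_reals all_analysis.

Import Order.TTheory GRing.Theory Num.Theory.

Local Open Scope classical_set_scope.
Local Open Scope ring_scope.

Lemma set_dist_ltP (R : realType) (X : metricType R) (x : X) (S : set X)
    (r : R) :
  (set_dist x S < r%:E)%E <-> exists2 s, S s & mdist x s < r.
Proof.
split; first by move/ereal_inf_ltP => [_ [s Ss <-]]; rewrite lte_fin; exists s.
by move=> [s Ss xs]; apply/ereal_inf_ltP; exists (mdist x s)%:E; [exists s|].
Qed.

(** Packages a bare distance function as a [metricType]: nonnegativity and the usual triangle
    inequality both follow from the strong one. The map [h] hides the structure built on [T]. *)
Lemma ultrametric_space (R : realType) (T : choiceType) (d : T -> T -> R) :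
  (forall x, d x x = 0) -> (forall x y, d x y = 0 -> x = y) ->
  (forall x y, d x y = d y x) ->
  (forall x y z, d x z <= Num.max (d x y) (d y z)) ->
  exists (Z : metricType R) (h : T -> Z),
    non_archimedean Z /\ forall x y, mdist (h x) (h y) = d x y.
Proof.
move=> dxx dpos dsym dna.
have dge0 x y : 0 <= d x y.
  by have := dna x y x; rewrite dxx [d y x]dsym maxxx.
have dtri y x z : d x z <= d x y + d y z.
  by rewrite (le_trans (dna x y z))// ge_max lerDl lerDr !dge0.
pose c := Choice.class T.
pose m := @isMetric.Axioms_ R T (Choice.choice_hasChoice_mixin c)
  (Choice.eqtype_hasDecEq_mixin c) d dxx dpos dsym dtri.
pose Z : metricType R := HB.pack_for (metricType R) T m.
by exists Z, id; split => //; exact: dna.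
Qed.

Lemma na_dist_le {R : realType} {X : metricType R} (X_na : non_archimedean X)
    (y : X) {r : R} {x z : X} :
  mdist x y <= r -> mdist y z <= r -> mdist x z <= r.
Proof. by move=> xy yz; rewrite (le_trans (X_na x y z))// ge_max xy. Qed.

Lemma na_dist_lt {R : realType} {X : metricType R} (X_na : non_archimedean X)
    (y : X) {r : R} {x z : X} :
  mdist x y < r -> mdist y z < r -> mdist x z < r.
Proof. by move=> xy yz; rewrite (le_lt_trans (X_na x y z))// gt_max xy. Qed.

(** If [x'] and [y'] were closer than [mdist x y], the chain [x], [x'], [y'], [y] would have all its
    steps shorter than the distance between its ends. *)
Lemma na_dist_isosceles {R : realType} {X : metricType R}
    (X_na : non_archimedean X) {x x' y y' : X} :
  mdist x x' < mdist x y -> mdist y y' < mdist x y ->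
  mdist x' y' = mdist x y.
Proof.
move=> xx' yy'; apply/eqP; rewrite eq_le; apply/andP; split.
  apply: (na_dist_le X_na x); first by rewrite metric_sym ltW.
  by apply: (na_dist_le X_na y) => //; rewrite ltW.
rewrite leNgt; apply/negP => x'y'.
suff : mdist x y < mdist x y by rewrite ltxx.
apply: (na_dist_lt X_na x') => //; apply: (na_dist_lt X_na y') => //.
by rewrite metric_sym.
Qed.

(** The hypotheses make [phi] preserve every distance above [eps] and keep the others at most [eps].
    The floor [eps] on cross distances hides this error and separates the two copies. *)
Lemma glued_ultrametric {R : realType} {X Y : metricType R}
    (X_na : non_archimedean X) (Y_na : non_archimedean Y)
    {eps : R} (eps_gt0 : 0 < eps) {phi : Y -> X}
    (phi_le : forall y y', mdist (phi y) (phi y') <= Num.max eps (mdist y y'))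
    (phi_ge : forall y y', mdist y y' <= Num.max eps (mdist (phi y) (phi y'))) :
  exists (Z : metricType R) (f : X -> Z) (g : Y -> Z),
    [/\ non_archimedean Z, isometric_embedding f, isometric_embedding g
      & forall x y, mdist (f x) (g y) = Num.max eps (mdist x (phi y))].
Proof.
pose d (u v : X + Y) : R := match u, v with
  | inl x, inl x' => mdist x x'
  | inl x, inr y | inr y, inl x => Num.max eps (mdist x (phi y))
  | inr y, inr y' => mdist y y'
  end.
have max_neq0 (a : R) : Num.max eps a <> 0.
  by apply/eqP; rewrite gt_eqF// lt_max eps_gt0.
have [| | | |Z [h [Z_na hd]]] := @ultrametric_space R (X + Y)%type d.
- by case=> ?; exact: mdistxx.
- by case=> [x|y] [x'|y'] //= => [/mdist_positivity ->|/max_neq0|/max_neq0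
    |/mdist_positivity ->].
- by case=> [x|y] [x'|y'] //=; rewrite metric_sym.
- have phi_le' y y' : mdist (phi y) (phi y') <= eps \/
      mdist (phi y) (phi y') <= mdist y y'.
    by apply/orP; rewrite -le_max.
  have phi_ge' y y' : mdist y y' <= eps \/
      mdist y y' <= mdist (phi y) (phi y').
    by apply/orP; rewrite -le_max.
  (* Each case becomes a chain of distances at most [M]. Any cross distance on the right also gives
     [eps <= M], which absorbs the [eps] alternative of [phi_le'] and [phi_ge']. *)
  move=> u v w; set M := Num.max _ _.
  have : d u v <= M by rewrite le_max lexx.
  have : d v w <= M by rewrite le_max lexx orbT.
  move: M => M; case: u v w => [x|y] [x'|y'] [x''|y''] /=; rewrite ?ge_max.
  + by move=> *; apply: (na_dist_le X_na x').
  + by move=> /andP[-> ?] ? /=; apply: (na_dist_le X_na x').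
  + move=> /andP[_ ?] /andP[_ ?]; apply: (na_dist_le X_na (phi y')) => //.
    by rewrite metric_sym.
  + move=> y'y'' /andP[epsM xy']; rewrite epsM /=.
    apply: (na_dist_le X_na (phi y')) => //.
    by have [/le_trans->|/le_trans->] := phi_le' y' y''.
  + move=> x'x'' /andP[epsM x'y]; rewrite epsM /=.
    by apply: (na_dist_le X_na x') => //; rewrite metric_sym.
  + move=> /andP[epsM x'y''] /andP[_ x'y].
    have [/le_trans->//|/le_trans->//] := phi_ge' y y''.
    by apply: (na_dist_le X_na x') => //; rewrite metric_sym.
  + move=> /andP[epsM x''y'] yy'; rewrite epsM /=.
    apply: (na_dist_le X_na (phi y')) => //; rewrite metric_sym.
    by have [/le_trans->|/le_trans->] := phi_le' y y'.
  + by move=> *; apply: (na_dist_le Y_na y').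
by exists Z, (h \o inl), (h \o inr); split => // [x x'|y y'|x y]; rewrite /= hd.
Qed.

Lemma strong_approximations_gh_le (R : realType) (X Y : metricType R)
    (X_na : non_archimedean X) (Y_na : non_archimedean Y)
    (eps : R) (eps_gt0 : 0 < eps) :
  strong_approximations eps X Y -> (na_gh_dist X Y <= eps%:E)%E.
Proof.
move=> [N [x [y [xnet ynet xy]]]].
have /choice[e ye] : forall y0, exists i, mdist y0 (y i) < eps.
  by move=> y0; have /set_dist_ltP[_ [i _ <-]] := ynet y0; exists i.
have [| |Z [f [g [Z_na fi gi fg]]]] :=
    glued_ultrametric X_na Y_na eps_gt0 (phi := x \o e).
- move=> y1 y2 /=; rewrite xy.
  apply: (na_dist_le Y_na y1); first by rewrite metric_sym le_max ltW.
  apply: (na_dist_le Y_na y2); first by rewrite le_max lexx orbT.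
  by rewrite le_max ltW.
- move=> y1 y2 /=; rewrite xy.
  apply: (na_dist_le Y_na (y (e y1))); first by rewrite le_max ltW.
  apply: (na_dist_le Y_na (y (e y2))); first by rewrite le_max lexx orbT.
  by rewrite metric_sym le_max ltW.
apply: (@le_trans _ _ (hausdorff_dist (range f) (range g))).
  by apply: ereal_inf_lbound; exists Z, f, g.
(* Cross distances are at least [eps] and thickenings are strict, so the radius has to exceed
   [eps]. *)
apply/lee_addgt0Pr => r r0; rewrite -EFinD; apply: ereal_inf_lbound.
have epsr : eps < eps + r by rewrite ltrDl.
exists (eps + r) => //; split; first exact: addr_gt0.
- move=> _ [x0 _ <-]; apply/set_dist_ltP.
  have /set_dist_ltP[_ [i _ <-] x0i] := xnet x0.
  exists (g (y i)) => //; rewrite fg gt_max epsr /= (le_lt_trans _ epsr)//.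
  (* The index [e (y i)] may differ from [i], but [x i] and [x (e (y i))] are as close as [y i] and
     [y (e (y i))]. *)
  apply: (na_dist_le X_na (x i)); first exact: ltW.
  by rewrite xy ltW.
- move=> _ [y0 _ <-]; apply/set_dist_ltP.
  exists (f (x (e y0))) => //.
  by rewrite metric_sym fg mdistxx gt_max epsr addr_gt0.
Qed.

(** Open balls of equal radius that meet coincide, so a choice depending only on the ball is
    constant on it. *)
Lemma ball_representatives {R : realType} {X : metricType R}
    (X_na : non_archimedean X) {eps : R} (eps_gt0 : 0 < eps) :
  exists rep : X -> X, (forall x, mdist x (rep x) < eps) /\
    forall x x', mdist (rep x) (rep x') < eps -> rep x = rep x'.
Proof.
pose rep (x : X) := xget x [set z | mdist x z < eps]; exists rep.
have xx (x : X) : [set z | mdist x z < eps] x by rewrite /= mdistxx.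
have xrep (x : X) : mdist x (rep x) < eps by exact: xgetI (xx x).
split=> // x x' repxx'.
have xx' : mdist x x' < eps.
  apply: (na_dist_lt X_na (rep x)) => //.
  by apply: (na_dist_lt X_na (rep x')) => //; rewrite metric_sym.
have E : [set z | mdist x z < eps] = [set z | mdist x' z < eps].
  apply/seteqP; split=> z /= h.
    by apply: (na_dist_lt X_na x) => //; rewrite metric_sym.
  exact: (na_dist_lt X_na x').
(* The two [xget] terms now differ only in their default value, which is never returned because the
   ball contains [x]. *)
rewrite /rep -E /xget; case: pselect => // noz.
by case: noz; exists x; apply/asboolP; exact: xx.
Qed.

Lemma separated_eps_net {R : realType} {X : metricType R}
    (X_compact : compact [set: X]) (X_na : non_archimedean X)
    {eps : R} (eps_gt0 : 0 < eps) :
  exists (N : nat) (x : 'I_N -> X), eps_net eps (range x) /\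
    forall i j, mdist (x i) (x j) < eps -> x i = x j.
Proof.
have [rep [xrep rep_inj]] := ball_representatives X_na eps_gt0.
have [[x0 _]|X0] := pselect (exists x0 : X, True); last first.
  (* In an empty space the empty family is a net. *)
  exists 0, (fun i : 'I_0 => False_rect X (notF (ltn_ord i))).
  by split=> [x|[]//]; case: X0; exists x.
(* The library states [compact_cover] for pointed spaces only. *)
pose m := isPointed.Build X x0.
pose pX : ptopologicalType := HB.pack_for ptopologicalType X m.
have : @cover_compact pX setT by rewrite -(@compact_cover pX).
move=> /(_ X setT (fun x => (ball x eps)^°)).
case=> [x _|x _|D _ Dcov]; first exact: open_interior.
  by exists x => //; exact: nbhsx_ballx.
pose s := finmap.enum_fset D.
(* Several centres may share a representative, hence separation concludes with equal points rather
   than equal indices. *)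
exists (size s), (fun i => rep (tnth (in_tuple s) i)); split; last first.
  by move=> i j; exact: rep_inj.
move=> x; have [//|z zD /interior_subset] := Dcov x.
rewrite ballEmdist /= metric_sym => xz; apply/set_dist_ltP.
have /tnthP[i zi] : z \in in_tuple s by [].
exists (rep z); first by exists i => //; rewrite -zi.
exact: (na_dist_lt X_na z).
Qed.

Lemma gh_lt_strong_approximations (R : realType) (X Y : metricType R)
    (X_compact : compact [set: X]) (X_na : non_archimedean X)
    (eps : R) (eps_gt0 : 0 < eps) :
  (na_gh_dist X Y < eps%:E)%E -> strong_approximations eps X Y.
Proof.
move=> /ereal_inf_ltP[_ [Z [f [g [Z_na fi gi ->]]]]].
move=> /ereal_inf_ltP[_ [r [r_gt0 fg gf] <-]]; rewrite lte_fin => r_eps.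
have /choice[h xh] : forall x, exists y, mdist (f x) (g y) < eps.
  move=> x; have /set_dist_ltP[_ [y _ <-] xy] := fg (f x) (imageT f x).
  by exists y; exact: lt_trans r_eps.
have [N [x [xnet xsep]]] := separated_eps_net X_compact X_na eps_gt0.
exists N, x, (h \o x); split => //.
- move=> y; have /set_dist_ltP[_ [x0 _ <-] yx0] := gf (g y) (imageT g y).
  have /set_dist_ltP[_ [i _ <-] x0i] := xnet x0.
  apply/set_dist_ltP; exists (h (x i)); first by exists i.
  (* The chain [g y], [f x0], [f (x i)], [g (h (x i))] has all its steps below [eps]. *)
  rewrite -gi; apply: (na_dist_lt Z_na (f x0)); first exact: lt_trans r_eps.
  by apply: (na_dist_lt Z_na (f (x i))); first rewrite fi.
- move=> i j /=; have [/xsep ->|eps_xx] := ltP (mdist (x i) (x j)) eps.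
    by rewrite !mdistxx.
  rewrite -fi -gi; apply/esym/(na_dist_isosceles Z_na);
    by rewrite fi; apply: lt_le_trans eps_xx.
Qed.

Theorem theoremC (R : realType) (X Y : metricType R)
    (X_compact : compact [set: X]) (X_na : non_archimedean X)
    (Y_compact : compact [set: Y]) (Y_na : non_archimedean Y)
    (eps : R) (eps_gt0 : 0 < eps) :
  (strong_approximations eps X Y -> (na_gh_dist X Y <= eps%:E)%E) /\
  ((na_gh_dist X Y < eps%:E)%E -> strong_approximations eps X Y).
Proof.
split; first exact: strong_approximations_gh_le.
exact: gh_lt_strong_approximations.
Qed.
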